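(* Let conditions (a)–(d) given in the context hold, and let $\theta^*=[\theta_i^*]_{i=1}^{k_{\theta,n}}$. Then $\theta_0=\mathbf{0}_{k_\theta}$ if and only if $|\theta^*-\mathbf{0}_{k_{\theta,n}}|\to 0$ as $n\to\infty$; hence under $H_0:\theta_0=\mathbf{0}_{k_\theta}$ the nuisance values satisfy $\delta_{(i)}^*=\delta_0$ ($1\le i\le k_{\theta,n}$) as $n\to\infty$. Under $H_1:\theta_0\neq\mathbf{0}_{k_\theta}$ it follows that $\lim_{n\to\infty}\max_{1\le i\le k_{\theta,n}}|\theta_i^*|>0$.
   Context: Let $k_\delta\in\mathbb{N}$ and $k_\theta\in\mathbb{N}\cup\{\infty\}$. $\mathcal{D}\subset\mathbb{R}^{k_\delta}$ is compact, $\Theta=\times_{i=1}^{k_\theta}\Theta_i$ with each $\Theta_i\subset\mathbb{R}$ non-empty and compact, and throughout $\Theta\subset\{\theta\in\mathbb{R}^{k_\theta}:|\theta|<\infty\}$, where $|\cdot|$ is the $\ell_1$-norm. $\mathcal{B}=\mathcal{D}\times\Theta$ and $\mathcal{B}_{(i)}=\mathcal{D}\times\Theta_i$, with elements $\beta=[\delta',\theta']'$ and $\beta_{(i)}=[\delta',\theta_i]'$. $\mathbf{0}_k$ is the zero vector of dimension $k$. Derivatives of functions with infinite dimensional argument are vectors of partial derivatives. We write $\mathcal{L}(\delta,\theta)$ for $\mathcal{L}(\beta)$. Conditions: (a) The number of parameterizations $k_{\theta,n}\in\mathbb{N}$, $k_{\theta,n}\le k_\theta$, is monotonically increasing in $n$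 with $k_{\theta,n}\to k_\theta$. (b) The loss $\mathcal{L}:\mathcal{D}\times\Theta\to[0,\infty)$ is continuous and differentiable on $\mathcal{B}$, and $\frac{\partial}{\partial\beta}\mathcal{L}(\beta)=0$ if and only if $\beta=\beta_0=[\delta_0',\theta_0']'\in\mathcal{B}$, where $\beta_0$ is unique (it is the unique minimizer of $\mathcal{L}$ on $\mathcal{B}$), and $\delta_0$ and $\theta_{0,i}$ are interior points of $\mathcal{D}$ and $\Theta_i$. (c) The parsimonious losses $\mathcal{L}_{(i)}:\mathcal{B}_{(i)}\to[0,\infty)$ are continuous and differentiable on $\mathcal{B}_{(i)}$. The $\beta_{(i)}^*$ (unique minimizer of $\mathcal{L}_{(i)}$ on $\mathcal{B}_{(i)}$) is the unique interior point of $\mathcal{D}\times\Theta_i$ satisfying: $\frac{\partial}{\partial\beta_{(i)}}\mathcal{L}_{(i)}(\beta_{(i)})=0$ if and only if $\beta_{(i)}=\beta_{(i)}^*=[\delta_{(i)}^{*\prime},\theta_i^*]'$. (d) $\mathcal{L}_{(i)}(\beta_{(i)})=\mathcal{L}(\delta,[0,\dots,\theta_i,0,\dots]')$ for all $\beta_{(i)}\in\mathcal{B}_{(i)}$, where $[0,\dots,\theta_i,0,\dots]'$ is the zero vector except for its $i$-th element $\theta_i$. *)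

(* Defs.v *)
From HB Require Import structures.
From mathcomp Require Import all_boot all_order all_algebra.
From mathcomp Require Import all_classical all_reals all_analysis.

Set Implicit Arguments.
Unset Strict Implicit.
Unset Printing Implicit Defensive.
Import Order.TTheory GRing.Theory Num.Theory.
Import numFieldNormedType.Exports.
Local Open Scope classical_set_scope.
Local Open Scope ring_scope.

(* A dimension in N u {oo} is an [option nat], [None] standing for oo.
   Coordinates are numbered from 0: the coordinates of R^k are the i with
   [below k i]. *)
Definition below (k : option nat) (i : nat) : bool :=
  if k is Some m then (i < m)%N else true.

Definition le_dim (m : nat) (k : option nat) : bool :=
  if k is Some p then (m <= p)%N else true.

(* Convergence in N u {oo}; on nat the topology is the discrete one. *)
Definition tends_to_dim (u : nat -> nat) (k : option nat) : Prop :=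
  if k is Some m then u @ \oo --> m else u @ \oo --> \oo.

Section Losses.
Context (R : realType) (kdelta : nat).

(* theta in R^k, k in N u {oo}, is a real sequence that vanishes outside the
   coordinates of R^k (enforced by [Theta] below). *)
Definition param : Type := ('rV[R]_kdelta * (nat -> R))%type.

Definition l1norm n (v : 'rV[R]_n) : R := \sum_(j < n) `|v 0 j|.

Definition l1norm_seq (t : nat -> R) : \bar R :=
  (\sum_(0 <= i <oo) `|t i|%:E)%E.

Definition l1norm_param (b : param) : \bar R :=
  ((l1norm b.1)%:E + l1norm_seq b.2)%E.

Definition coord (i : nat) (t : R) : nat -> R := fun l => if l == i then t else 0.

(* The product of the Theta_i. *)
Definition Theta (k : option nat) (Theta_ : nat -> set R) : set (nat -> R) :=
  [set t | forall i, if below k i then Theta_ i (t i) else t i = 0].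

Definition B (k : option nat) (D : set 'rV[R]_kdelta) (Theta_ : nat -> set R) :
  set param := D `*` Theta k Theta_.

Definition Bi (D : set 'rV[R]_kdelta) (Theta_ : nat -> set R) (i : nat) :
  set ('rV[R]_kdelta * R) := D `*` Theta_ i.

Definition unique_minimizer T (A : set T) (f : T -> R) (x : T) : Prop :=
  A x /\ forall y, A y -> y <> x -> f x < f y.

Definition l1_continuous_on (A : set param) (L : param -> R) : Prop :=
  forall x, A x -> forall e : R, 0 < e -> exists2 d : R, 0 < d &
    forall y, A y -> (l1norm_param (y - x)%R < d%:E)%E -> `|L y - L x| < e.

(* All derivatives are taken within the domain, so that they make sense on its
   boundary.  A gradient is an element of [param] (partial derivatives in
   delta, partial derivatives in theta). *)

Definition partial_at (A : set param) (L : param -> R) (x v : param) (d : R) :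
  Prop :=
  h^-1 * (L (x + h *: v) - L x) @[h --> within [set h | A (x + h *: v)] 0^']
    --> d.

Definition partials_at (k : option nat) (A : set param) (L : param -> R)
    (x g : param) : Prop :=
  (forall j, partial_at A L x (delta_mx 0 j, fun=> 0) (g.1 0 j)) /\
  (forall i, below k i -> partial_at A L x (0, coord i 1) (g.2 i)).

Definition frechet_at (m : nat) (A : set param) (L : param -> R)
    (x g : param) : Prop :=
  forall e : R, 0 < e -> exists2 d : R, 0 < d &
    forall y, A y -> (l1norm_param (y - x)%R < d%:E)%E ->
      (`| L y - L x - (\sum_(j < kdelta) g.1 0 j * (y.1 0 j - x.1 0 j)
                       + \sum_(i < m) g.2 i * (y.2 i - x.2 i)) |%:E
        <= e%:E * l1norm_param (y - x)%R)%E.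

(* In finite dimension the derivative is the usual (Frechet) one; with an
   infinite dimensional argument it is the vector of partial derivatives. *)
Definition gradient_at (k : option nat) (A : set param) (L : param -> R)
    (x g : param) : Prop :=
  if k is Some m then frechet_at m A L x g else partials_at k A L x g.

Definition gradient_zero (k : option nat) (g : param) : Prop :=
  g.1 = 0 /\ forall i, below k i -> g.2 i = 0.

(* Gradient of a function of (delta, theta_i), a finite dimensional argument. *)
Definition gradienti_at (A : set ('rV[R]_kdelta * R))
    (f : 'rV[R]_kdelta * R -> R) (x g : 'rV[R]_kdelta * R) : Prop :=
  forall e : R, 0 < e -> \forall y \near within A (nbhs x),
    `| f y - f x - (\sum_(j < kdelta) g.1 0 j * (y.1 0 j - x.1 0 j)
                    + g.2 * (y.2 - x.2)) | <= e * `|y - x|.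

(* (theta_i^* )_{i < n}, where betas i = (delta_(i)^*, theta_i^* ). *)
Definition thetastar (betas : nat -> 'rV[R]_kdelta * R) (n : nat) : 'rV[R]_n :=
  \row_(i < n) (betas i).2.

Definition setting (k : option nat) (D : set 'rV[R]_kdelta)
    (Theta_ : nat -> set R) : Prop :=
  [/\ compact D,
      forall i, below k i -> Theta_ i !=set0 /\ compact (Theta_ i) &
      forall t, Theta k Theta_ t -> (l1norm_seq t < +oo)%E].

Definition condition_a (k : option nat) (kn : nat -> nat) : Prop :=
  [/\ forall n, le_dim (kn n) k,
      {homo kn : m n / (m <= n)%N} &
      tends_to_dim kn k].

(* [dL] is the derivative of [L] on the whole of B.  Where a derivative within
   B is not uniquely determined (isolated points, say), any version is
   allowed. *)
Definition condition_b (k : option nat) (D : set 'rV[R]_kdelta)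
    (Theta_ : nat -> set R) (L : param -> R) (beta0 : param) : Prop :=
  let B := B k D Theta_ in
  [/\ forall b, B b -> 0 <= L b,
      l1_continuous_on B L,
      exists2 dL : param -> param,
        forall b, B b -> gradient_at k B L b (dL b) &
        forall b, B b -> (gradient_zero k (dL b) <-> b = beta0),
      unique_minimizer B L beta0 &
      interior D beta0.1 /\
      forall i, below k i -> interior (Theta_ i) (beta0.2 i)].

Definition condition_c (k : option nat) (D : set 'rV[R]_kdelta)
    (Theta_ : nat -> set R) (Li : nat -> 'rV[R]_kdelta * R -> R)
    (betas : nat -> 'rV[R]_kdelta * R) : Prop :=
  forall i, below k i ->
  let Bi := Bi D Theta_ i in
  [/\ forall b, Bi b -> 0 <= Li i b,
      {within Bi, continuous (Li i)},
      exists2 dLi : 'rV[R]_kdelta * R -> 'rV[R]_kdelta * R,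
        forall b, Bi b -> gradienti_at Bi (Li i) b (dLi b) &
        forall b, Bi b -> (dLi b = 0 <-> b = betas i),
      unique_minimizer Bi (Li i) (betas i) &
      interior Bi (betas i)].

(* The membership clause says that L(delta, [0,...,theta_i,0,...]) makes sense,
   L being defined on D x Theta only. *)
Definition condition_d (k : option nat) (D : set 'rV[R]_kdelta)
    (Theta_ : nat -> set R) (L : param -> R)
    (Li : nat -> 'rV[R]_kdelta * R -> R) : Prop :=
  forall i, below k i -> forall b, Bi D Theta_ i b ->
    B k D Theta_ (b.1, coord i b.2) /\ Li i b = L (b.1, coord i b.2).

End Losses.

(* Main.v *)
Require Import Defs.
From HB Require Import structures.
From mathcomp Require Import all_boot all_order all_algebra.
From mathcomp Require Import all_classical all_reals all_analysis.
Set Implicit Arguments.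
Unset Strict Implicit.
Unset Printing Implicit Defensive.
Import Order.TTheory GRing.Theory Num.Theory.
Import numFieldNormedType.Exports.
Local Open Scope classical_set_scope.
Local Open Scope ring_scope.

(** The two directions rest on condition (d), which says that [Li i] is [L]
    restricted to the slice of the points whose only possibly nonzero
    theta-coordinate is the i-th.

    If theta0 = 0, then beta0 lies in every slice, and the minimizer of [L] on
    the whole of B is a fortiori its minimizer on the slice, so that
    beta_(i)^* = (delta0, 0) by uniqueness ([betas_null]).

    Conversely, let all theta_i^* vanish.  The slices meet in the points
    (delta, 0), so that every delta_(i)^* minimizes delta |-> L(delta, 0), and
    uniqueness in a single slice makes them one point delta^*.  At (delta^*, 0)
    the vanishing gradients of the [Li i] together give the vanishing of all
    the partial derivatives of [L]: each coordinate direction of B lies in some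
    slice.  As beta0 is the only critical point of [L], theta0 = 0
    ([theta0_null]).

    What remains is about limits.  The l1 norm of theta^* and the maximum of
    the |theta_i^*| are nondecreasing in n and, since k_n tends to k, every
    coordinate below k is eventually counted: the norm tends to 0 only if all
    theta_i^* vanish, and one nonzero theta_i^* keeps the maximum away from 0.
    The maximum converges since the sequence of the theta_i^* is itself a
    point of Theta, and hence summable ([betas_bounded]). *)

(** * Norms of coordinate vectors *)

Lemma coord0 (R : realType) (i : nat) : Defs.coord i (0 : R) = fun=> 0.
Proof. by apply/funext => l; rewrite /Defs.coord; case: ifP. Qed.

Section Norms.
Context (R : realType) (kdelta : nat).

Lemma l1norm_ge0 n (v : 'rV[R]_n) : 0 <= l1norm v.
Proof. exact: sumr_ge0. Qed.

Lemma l1norm_delta n (j : 'I_n) : l1norm (delta_mx 0 j : 'rV[R]_n) = 1.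
Proof.
rewrite /l1norm (bigD1 j) //= mxE !eqxx normr1 big1 ?addr0 // => i ij.
by rewrite mxE (negbTE ij) andbF normr0.
Qed.

Lemma l1norm0 n : l1norm (0 : 'rV[R]_n) = 0.
Proof. by rewrite /l1norm big1 // => j _; rewrite mxE normr0. Qed.

Lemma l1norm_seq_coord i (t : R) : l1norm_seq (Defs.coord i t) = `|t|%:E.
Proof.
rewrite /l1norm_seq (@nneseries_split _ _ 0 i.+1); last first.
  by move=> *; rewrite lee_fin.
rewrite eseries0 => [|l]; last first.
  by rewrite /Defs.coord add0n => il _; rewrite gtn_eqF // normr0.
rewrite add0n big_nat_recr //= big_nat big1 => [|l /andP[_ li]]; last first.
  by rewrite /Defs.coord ltn_eqF // normr0.
by rewrite add0e adde0 /Defs.coord eqxx.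
Qed.

Lemma l1norm_paramZ (h : R) (v : param R kdelta) :
  l1norm_param (h *: v) = (`|h|%:E * l1norm_param v)%E.
Proof.
rewrite /l1norm_param ge0_muleDr ?lee_fin ?l1norm_ge0 //; last first.
  by apply: nneseries_ge0 => *; rewrite lee_fin.
congr (_ + _)%E.
  rewrite -EFinM /l1norm mulr_sumr; congr (_%:E).
  by apply: eq_bigr => j _; rewrite /= mxE normrM.
rewrite /l1norm_seq -nneseriesZl //.
by apply: eq_eseriesr => i _; rewrite -EFinM -normrM.
Qed.

Lemma le_l1norm_seq (t : nat -> R) i : (`|t i|%:E <= l1norm_seq t)%E.
Proof.
rewrite /l1norm_seq (@nneseries_split _ _ 0 i.+1); last first.
  by move=> *; rewrite lee_fin.
rewrite add0n big_nat_recr //=.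
rewrite -addeA addeC -addeA leeDl // adde_ge0 //.
  by apply: nneseries_ge0 => *; rewrite lee_fin.
by apply: sume_ge0 => *; rewrite lee_fin.
Qed.

End Norms.

(** * Critical points along coordinate directions *)

Section Flat.
Context (R : realType) (kdelta : nat).
Implicit Types (A : set (param R kdelta)) (L : param R kdelta -> R)
  (x v g : param R kdelta).

(** [f] has derivative 0 at [x] along [v], and [x] is interior to [A] along
    that line.  This is the common ground between the gradients of [Li i] and
    of [L], which are taken on different spaces and, for [L], in a sense that
    depends on the dimension. *)
Definition flat_along (V : lmodType R) (A : set V) (f : V -> R) (x v : V) :=
  forall e : R, 0 < e ->
    \forall h \near (0 : R), A (x + h *: v) /\
      `|f (x + h *: v) - f x| <= e * `|h|.

(** The points of the line near [x] all belong to [A], so that the limit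
    within [A] is an ordinary one, and unique. *)
Lemma partial_at_flat A L x v d :
  partial_at A L x v d -> flat_along A L x v -> d = 0.
Proof.
move=> Ld Lflat.
have Ld' : h^-1 * (L (x + h *: v) - L x) @[h --> (0 : R)^'] --> d.
  move=> P /Ld FP.
  have A0 : \forall h \near 0^', A (x + h *: v).
    apply: nbhs_dnbhs.
    by apply: filterS (Lflat 1 ltr01) => h [].
  by apply: filterS2 A0 FP => h Ah; apply.
apply: (cvg_unique (@norm_hausdorff _ R) Ld').
apply/cvgr0Pnorm_le => e e0.
near=> h.
have h0 : h != 0 by near: h; exact: nbhs_dnbhs_neq.
have [_ hle] : A (x + h *: v) /\ `|L (x + h *: v) - L x| <= e * `|h|.
  by near: h; apply: nbhs_dnbhs; exact: Lflat.
by rewrite normrM normfV mulrC ler_pdivrMr ?normr_gt0.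
Unshelve. all: by end_near. Qed.

(** Along the line, the increment of [L] and the Frechet remainder are both
    o(h), hence so is their difference, [h] times the pairing of [g] and [v]. *)
Lemma frechet_at_flat m A L x g v :
  frechet_at m A L x g -> l1norm_param v = 1%E -> flat_along A L x v ->
  \sum_(j < kdelta) g.1 0 j * v.1 0 j + \sum_(i < m) g.2 i * v.2 i = 0.
Proof.
move=> Lg v1 Lflat; set s := (X in X = 0).
apply/normr0_eq0/eqP; rewrite eq_le normr_ge0 andbT.
apply/ler_addgt0Pr => e e0; rewrite add0r.
have e2 : 0 < e / 2 by rewrite divr_gt0.
have [d d0 Ld] := Lg _ e2.
near (0 : R)^' => h.
have h0 : h != 0 by near: h; exact: nbhs_dnbhs_neq.
have hd : `|h| < d by near: h; exact: dnbhs0_lt.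
have [Ah fh] : A (x + h *: v) /\ `|L (x + h *: v) - L x| <= e / 2 * `|h|.
  by near: h; apply: nbhs_dnbhs; exact: Lflat.
have := Ld _ Ah; rewrite addrC addKr l1norm_paramZ v1 mule1 lte_fin.
move=> /(_ hd); rewrite -EFinM lee_fin.
set t := (X in _ - X); have -> : t = h * s.
  rewrite /t /s mulrDr !mulr_sumr; congr (_ + _); apply: eq_bigr => i _ /=.
    by rewrite !mxE [X in _ * X]addrC addKr mulrCA.
  by rewrite -[(x.2 + h *: v.2) i]/(x.2 i + h * v.2 i) [X in _ * X]addrC addKr mulrCA.
move=> gh.
have : `|h * s| <= e * `|h|.
  rewrite (splitr e) mulrDl.
  rewrite -(subKr (L (x + h *: v) - L x) (h * s)).
  by apply: (le_trans (ler_normB _ _)); exact: lerD.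
by rewrite normrM mulrC ler_pM2r ?normr_gt0.
Unshelve. all: by end_near. Qed.

Lemma gradient_zero_flat k A L x g :
  gradient_at k A L x g ->
  (forall j, flat_along A L x (delta_mx 0 j, fun=> 0)) ->
  (forall i, below k i -> flat_along A L x (0, Defs.coord i 1)) ->
  gradient_zero k g.
Proof.
case: k => [m|] /= Lg fdelta ftheta; split.
- apply/rowP => j; rewrite mxE.
  have := frechet_at_flat Lg _ (fdelta j).
  rewrite /= (bigD1 j) //= mxE !eqxx mulr1 [X in _ + X + _]big1 => [|l lj]; last first.
    by rewrite mxE (negbTE lj) andbF mulr0.
  rewrite big1 => [|l _]; last by rewrite mulr0.
  rewrite !addr0; apply.
  by rewrite /l1norm_param l1norm_delta -(coord0 R 0) l1norm_seq_coord normr0 adde0.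
- move=> i im.
  have := frechet_at_flat Lg _ (ftheta i im).
  rewrite /= big1 => [|l _]; last by rewrite mxE mulr0.
  rewrite (bigD1 (Ordinal im)) //= big1 => [|l li]; last first.
    have il : (l : nat) == i = false.
      by apply: contra_neqF li => /eqP li; apply/val_inj.
    by rewrite /Defs.coord il mulr0.
  rewrite /Defs.coord eqxx mulr1 add0r addr0; apply.
  by rewrite /l1norm_param l1norm0 l1norm_seq_coord normr1 add0e.
- by apply/rowP => j; rewrite mxE; apply: partial_at_flat (fdelta j); exact: Lg.1.
- by move=> i ki; apply: partial_at_flat (ftheta i ki); exact: Lg.2.
Qed.

(** Any path through an interior point stays in [A] for a while, and along a
    line the bound in norm is a bound in the step [h]. *)
Lemma gradienti_at0_flat (A : set ('rV[R]_kdelta * R)) f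
    (x v : 'rV[R]_kdelta * R) :
  gradienti_at A f x 0 -> interior A x -> flat_along A f x v.
Proof.
move=> f0 Ax e e0.
(* The step [h *: v] has norm [`|h| * `|v|]; the 1 covers [v = 0]. *)
have v0 : 0 < 1 + `|v| by rewrite ltr_pwDl.
have ev0 : 0 < e / (1 + `|v|) by rewrite divr_gt0.
have xh : x + h *: v @[h --> (0 : R)] --> x.
  rewrite -[X in _ --> X]addr0 -(scale0r v).
  by apply: cvgD; [exact: cvg_cst | apply: cvgZr_tmp; exact: cvg_id].
have AN : \forall y \near x, A y by exact: Ax.
have fN := f0 _ ev0; rewrite /= /within /= in fN.
have Ahs : \forall h \near (0 : R), A (x + h *: v) := xh _ AN.
have fhs := xh _ fN; rewrite /= /nbhs /= in fhs.
apply: filterS2 Ahs fhs => h Ah fh.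
split=> //; have {fh} := fh Ah.
rewrite big1 => [|j _]; last by rewrite mxE mul0r.
rewrite mul0r addr0 subr0 => /le_trans; apply.
rewrite (addrC x) addrK normrZ mulrCA [leRHS]mulrC ler_wpM2l //.
by rewrite mulrAC ler_pdivrMr // ler_pM2l // lerDr.
Qed.

End Flat.

(** * Minimizers of the loss and of its restrictions to the slices *)

Section Corollary.
Context (R : realType) (kdelta : nat) (k : option nat) (D : set 'rV[R]_kdelta)
  (Theta_ : nat -> set R) (L : param R kdelta -> R) (beta0 : param R kdelta)
  (Li : nat -> 'rV[R]_kdelta * R -> R) (betas : nat -> 'rV[R]_kdelta * R).
Hypotheses (cb : condition_b k D Theta_ L beta0)
  (cc : condition_c k D Theta_ Li betas) (cd : condition_d k D Theta_ L Li).

(** The point (delta0, 0) of the slice is beta0, and [L] is at least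
    [L beta0] at beta_(i)^*. *)
Lemma betas_null : beta0.2 = (fun=> 0) ->
  forall i, below k i -> betas i = (beta0.1, 0).
Proof.
move=> th0 i ki; case: cb => _ _ _ [[Dd0 Th0] min0] _.
have [_ _ _ [Bs mins] _] := cc ki.
have Bi0 : Bi D Theta_ i (beta0.1, 0).
  by split=> //=; move: (Th0 i); rewrite ki th0.
have [Bbs Ls] := cd ki Bs; have [_ L0] := cd ki Bi0.
apply: contrapT => /nesym /(mins _ Bi0); rewrite Ls L0 /= coord0 -th0.
rewrite -surjective_pairing ltNge => /negP; apply.
have [->//|ne] := pselect (((betas i).1, Defs.coord i (betas i).2) = beta0).
exact/ltW/min0.
Qed.

(** The point (delta_(0)^*, 0) is critical for [L] because it is the
    minimizer of every [Li i], and so it is beta0. *)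
Lemma theta0_null :
  (forall i, below k i -> (betas i).2 = 0) -> beta0.2 = (fun=> 0).
Proof.
move=> ths; case: cb => _ _ [dL dLP dL0] [[_ Th0] _] _.
(* The delta-directions need at least one slice. *)
have [k0|k0] := boolP (below k 0); last first.
  apply/funext => i; move: (Th0 i) k0; case: k => [[|m]|] //=.
pose ds := (betas 0).1; pose b : param R kdelta := (ds, fun=> 0).
have b0 : betas 0 = (ds, 0) by rewrite (surjective_pairing (betas 0)) ths.
have Li0 i d : below k i -> D d ->
    [/\ Bi D Theta_ i (d, 0), B k D Theta_ (d, fun=> 0) &
      Li i (d, 0) = L (d, fun=> 0)].
  move=> ki Dd; have [_ _ _ [[_ Ths] _] _] := cc ki.
  have Bd : Bi D Theta_ i (d, 0) by split=> //=; rewrite -(ths i ki).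
  by have [] := cd ki Bd; rewrite coord0.
have Dbs i : below k i -> D (betas i).1.
  by move=> ki; have [_ _ _ [[? _] _] _] := cc ki.
have bE i : below k i -> betas i = (ds, 0).
  move=> ki; rewrite (surjective_pairing (betas i)) ths //.
  (* Otherwise delta_(0)^* and delta_(i)^* would each be strictly better
     than the other for [fun d => L (d, 0)]. *)
  apply: contrapT => ne.
  have [_ _ _ [_ mini] _] := cc ki; have [_ _ _ [_ min0] _] := cc k0.
  have [Bi1 _ E1] := Li0 i _ ki (Dbs 0%N k0).
  have [Bi2 _ E2] := Li0 0%N _ k0 (Dbs i ki).
  have [_ _ E3] := Li0 i _ ki (Dbs i ki).
  have [_ _ E4] := Li0 0%N _ k0 (Dbs 0%N k0).
  have := mini _ Bi1; rewrite {2}(surjective_pairing (betas i)) ths // E1.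
  rewrite (surjective_pairing (betas i)) ths // E3 => /(_ (nesym ne)) lt1.
  have := min0 _ Bi2; rewrite b0 E2 E4 => /(_ ne) lt2.
  by have := lt_trans lt1 lt2; rewrite ltxx.
have Bb : B k D Theta_ b by have [] := Li0 0%N ds k0 (Dbs 0%N k0).
have flatb i (u : 'rV[R]_kdelta) (t : R) : below k i ->
    flat_along (B k D Theta_) L b (u, Defs.coord i t).
  move=> ki e e0.
  have [_ _ [dLi dLiP dLi0] [Bs _] Bint] := cc ki.
  have := dLiP _ Bs; rewrite (dLi0 _ Bs).2 // => flati.
  have := gradienti_at0_flat (u, t) flati Bint e0; rewrite bE //.
  apply: filterS => h [Bh fh].
  have [_ _ E] := Li0 i ds ki (Dbs 0%N k0).
  have [Bh' Eh] := cd ki Bh; move: fh; rewrite E Eh.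
  have -> : b + h *: (u, Defs.coord i t) =
      (((ds, 0) + h *: (u, t)).1, Defs.coord i ((ds, 0) + h *: (u, t)).2).
    congr (_, _); apply/funext => l; rewrite /= /Defs.coord.
    rewrite -[LHS]/(0 + h * (if l == i then t else 0)) !add0r.
    by case: ifP; rewrite ?mulr0.
  by [].
have : b = beta0.
  apply/(dL0 _ Bb); apply: (gradient_zero_flat (dLP _ Bb)) => [j|i ki].
    rewrite -(coord0 R 0); exact: flatb.
  exact: flatb.
by move=> <-.
Qed.

(** Extended by 0, the sequence of the theta_i^* belongs to Theta, all of
    whose points have finite l1 norm, and this norm bounds each coordinate. *)
Lemma betas_bounded : setting k D Theta_ ->
  exists M : R, forall i, below k i -> `|(betas i).2| <= M.
Proof.
move=> [_ _ fin].
pose t i : R := if below k i then (betas i).2 else 0.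
have Tt : Theta k Theta_ t.
  move=> i; rewrite /t; case ki: (below k i) => //.
  by have [_ _ _ [[_ ?] _] _] := cc ki.
exists (fine (l1norm_seq t)) => i ki.
have ft : l1norm_seq t \is a fin_num.
  by rewrite ge0_fin_numE ?fin //; apply: nneseries_ge0 => *; rewrite lee_fin.
have -> : (betas i).2 = t i by rewrite /t ki.
by rewrite -lee_fin (fineK ft) le_l1norm_seq.
Qed.

End Corollary.

(** * The corollary *)

Lemma near_below (k : option nat) (kn : nat -> nat) i :
  tends_to_dim kn k -> below k i -> \forall n \near \oo, (i < kn n)%N.
Proof.
case: k => [m|] /= knk im.
  by apply: (knk [set p | i < p]%N); exact/principal_filterP.
exact: (knk _ (nbhs_infty_gt i)).
Qed.

Lemma below_le (k : option nat) m i : le_dim m k -> (i < m)%N -> below k i.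
Proof. by case: k => //= p mp im; exact: leq_trans mp. Qed.

Theorem corollary2p2 (R : realType) (kdelta : nat) (ktheta : option nat)
    (D : set 'rV[R]_kdelta) (Theta_ : nat -> set R)
    (kn : nat -> nat)
    (L : param R kdelta -> R) (beta0 : param R kdelta)
    (Li : nat -> 'rV[R]_kdelta * R -> R)
    (betas : nat -> 'rV[R]_kdelta * R) :
  setting ktheta D Theta_ ->
  condition_a ktheta kn ->
  condition_b ktheta D Theta_ L beta0 ->
  condition_c ktheta D Theta_ Li betas ->
  condition_d ktheta D Theta_ L Li ->
  [/\ beta0.2 = (fun=> 0) <->
        l1norm (thetastar betas (kn n) - 0) @[n --> \oo] --> (0 : R),
      beta0.2 = (fun=> 0) ->
        forall n i, (i < kn n)%N -> (betas i).1 = beta0.1 &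
      beta0.2 <> (fun=> 0) ->
        let M := fun n => \big[Num.max/0]_(i < kn n) `|(betas i).2| in
        cvgn M /\ 0 < limn M].
Proof.
move=> set_ [kn_le kn_homo kn_lim] cb cc cd.
have kP n i : (i < kn n)%N -> below ktheta i by exact: below_le.
have M_ge n i : (i < kn n)%N ->
    `|(betas i).2| <= \big[Num.max/0]_(i < kn n) `|(betas i).2|.
  by move=> ikn; exact: (le_bigmax _ (fun j : 'I__ => `|(betas j).2|) (Ordinal ikn)).
split.
- split=> [th0|cv].
    apply: cvg_near_cst; apply: nearW => n; rewrite /l1norm big1 // => i _.
    by rewrite !mxE (betas_null cb cc cd th0) ?(kP n) //= subr0 normr0.
  apply: (theta0_null cb cc cd) => i ki; apply/normr0_eq0/eqP.
  rewrite eq_le normr_ge0 andbT; apply: (cvgr_to_ge cv).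
  apply: filterS (near_below kn_lim ki) => n ikn.
  rewrite /l1norm (bigD1 (Ordinal ikn)) //= !mxE subr0 lerDl.
  exact: sumr_ge0.
- by move=> th0 n i ikn; rewrite (betas_null cb cc cd th0) ?(kP n).
- move=> th0 M.
  have M_homo : nondecreasing_seq M.
    move=> m n mn; apply: (le_bigmax_ord xpredT (fun i => `|(betas i).2|)).
    exact: kn_homo.
  have [C CP] := betas_bounded cc set_.
  have M_cvg : cvgn M.
    apply: nondecreasing_is_cvgn => //; exists (Num.max 0 C) => _ [n _ <-].
    by apply: bigmax_le => [|i _]; rewrite le_max ?lexx // CP ?orbT ?(kP n).
  split=> //.
  have [i ki thi] : exists2 i, below ktheta i & (betas i).2 <> 0.
    apply: contrapT => nex; apply: th0; apply: (theta0_null cb cc cd) => i ki.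
    by apply: contrapT => thi; apply: nex; exists i.
  apply: (@lt_le_trans _ _ `|(betas i).2|); first by rewrite normr_gt0; exact/eqP.
  apply: limr_ge => //; apply: filterS (near_below kn_lim ki) => n; exact: M_ge.
Qed.
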